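(* Let $\Bbbk$ be a commutative ring with unit and let $A$ be an XC-algebra over $\Bbbk$ with universal $R$-matrix $R$ and balancing element $\kappa$. Then every finite-free $A$-module $(V,\rho)$, where $\rho:A\to\mathrm{End}_\Bbbk(V)$ is the structure homomorphism, gives rise to a traced XC-algebra structure on $\mathrm{End}_\Bbbk(V)$ with universal $R$-matrix $(\rho\otimes\rho)(R)$ and balancing element $\rho(\kappa)$ (the trace being the usual trace of endomorphisms).
   Context: An XC-algebra over $\Bbbk$ is a $\Bbbk$-algebra $A$ with invertible elements $R=\sum_i\alpha_i\otimes\beta_i\in A\otimes A$ (with inverse $R^{-1}=\sum_i\bar\alpha_i\otimes\bar\beta_i$), called the universal $R$-matrix, and $\kappa\in A$, called the balancing element, such that (XC0) $R^{\pm1}=(\kappa\otimes\kappa)R^{\pm1}(\kappa^{-1}\otimes\kappa^{-1})$; (XC1f) $\sum_i\beta_i\kappa\alpha_i=\sum_i\alpha_i\kappa^{-1}\beta_i$; (XC2c) $1\otimes\kappa^{-1}=\sum_{i,j}\alpha_i\bar\alpha_j\otimes\bar\beta_j\kappa^{-1}\beta_i$; (XC2d) $\kappa\otimes1=\sum_{i,j}\bar\alpha_j\kappa\alpha_i\otimes\beta_i\bar\beta_j$; (XC3) $R_{12}R_{13}R_{23}=R_{23}R_{13}R_{12}$. A traced XC-algebra is an XC-algebra together with a $\Bbbk$-linear map $\mathrm{tr}:A\to\Bbbk$ with $\mathrm{tr}(ab)=\mathrm{tr}(ba)$ for all $a,b\in A$. An $A$-module $V$ is viewed as a $\Bbbk$-algebra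 homomorphism $\rho:A\to\mathrm{End}_\Bbbk(V)$, where the product in $\mathrm{End}_\Bbbk(V)$ is composition; finite-free means free of finite rank over $\Bbbk$. *)

(* Defs.v *)
From HB Require Import structures.
From mathcomp Require Import all_boot all_order all_algebra.
From mathcomp Require Import boolp classical_sets.

Set Implicit Arguments.
Unset Strict Implicit.
Unset Printing Implicit Defensive.

Import GRing.Theory.
Local Open Scope ring_scope.
Local Open Scope quotient_scope.

Reserved Notation "c **: x" (at level 40).
Reserved Notation "x \ox y" (at level 40, left associativity).

(* Unital associative algebras over a commutative ring. MathComp's algType    *)
(* extends nzRingType and so excludes the zero algebra, which occurs here as  *)
(* the endomorphism ring of the zero module (and over the zero ring). A join  *)
(* of lmodType and pzRingType cannot be inserted below lalgType from outside  *)
(* the library, so the scalar action is carried by this mixin.                *)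
HB.mixin Record PzRing_isPzAlgebra (k : comPzRingType) A of GRing.PzRing A := {
  ascale : k -> A -> A;
  ascaleA : forall c d x, ascale c (ascale d x) = ascale (c * d) x;
  ascale1 : forall x, ascale 1 x = x;
  ascaleDr : forall c x y, ascale c (x + y) = ascale c x + ascale c y;
  ascaleDl : forall x c d, ascale (c + d) x = ascale c x + ascale d x;
  ascaleAl : forall c x y, ascale c (x * y) = ascale c x * y;
  ascaleAr : forall c x y, ascale c (x * y) = x * ascale c y }.

#[short(type="pzAlgType")]
HB.structure Definition PzAlgebra (k : comPzRingType) :=
  {A of GRing.PzRing A & PzRing_isPzAlgebra k A}.

Notation "c **: x" := (ascale c x) : ring_scope.

Record alg_hom (k : comPzRingType) (A B : pzAlgType k) := AlgHom {
  alg_hom_rmorph :> {rmorphism A -> B};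
  alg_homZ : forall (c : k) (a : A),
    alg_hom_rmorph (c **: a) = c **: alg_hom_rmorph a }.

Section AlgebraTheory.
Variables (k : comPzRingType) (A : pzAlgType k).
Implicit Types (c : k) (x : A).

Lemma ascale0r x : (0 : k) **: x = 0.
Proof. by apply: (addIr ((0 : k) **: x)); rewrite -ascaleDl !add0r. Qed.

Lemma ascaler0 c : c **: (0 : A) = 0.
Proof. by apply: (addIr (c **: (0 : A))); rewrite -ascaleDr !add0r. Qed.

Lemma ascaleN1 x : (-1 : k) **: x = - x.
Proof.
by apply: (addIr x); rewrite addNr -{2}[x](ascale1 (s := A)) -ascaleDl addNr ascale0r.
Qed.

Lemma ascale_sum c I (r : seq I) (P : pred I) (F : I -> A) :
  c **: (\sum_(i <- r | P i) F i) = \sum_(i <- r | P i) c **: F i.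
Proof.
by elim/big_rec2: _ => [|i y z _ <-]; rewrite ?ascaler0 // ascaleDr.
Qed.
End AlgebraTheory.

Section Tensor.
Variables (k : comPzRingType) (A B : pzAlgType k).
Implicit Types (a : A) (b : B) (c : k) (s t : seq (A * B)).

(* A formal sum of pure tensors is a list of pairs; tens_eq is the congruence *)
(* presenting the tensor product over k as a commutative monoid. It is a      *)
(* group because (- a, b) is then inverse to (a, b).                          *)
Inductive tens_eq : seq (A * B) -> seq (A * B) -> Prop :=
| tens_eq_refl s : tens_eq s s
| tens_eq_sym s t : tens_eq s t -> tens_eq t s
| tens_eq_trans s t u : tens_eq s t -> tens_eq t u -> tens_eq s u
| tens_eq_cat s s' t t' : tens_eq s s' -> tens_eq t t' ->
    tens_eq (s ++ t) (s' ++ t')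
| tens_eq_catC s t : tens_eq (s ++ t) (t ++ s)
| tens_eq_0l b : tens_eq [:: (0, b)] [::]
| tens_eq_0r a : tens_eq [:: (a, 0)] [::]
| tens_eq_Dl a a' b : tens_eq [:: (a + a', b)] [:: (a, b); (a', b)]
| tens_eq_Dr a b b' : tens_eq [:: (a, b + b')] [:: (a, b); (a, b')]
| tens_eq_Z c a b : tens_eq [:: (c **: a, b)] [:: (a, c **: b)].

Definition tens_eqb s t := `[< tens_eq s t >].

Fact tens_eqb_equiv : equiv_class_of tens_eqb.
Proof.
split => [s|s t|t s u].
- exact/asboolP/tens_eq_refl.
- by apply/asboolP/asboolP; apply: tens_eq_sym.
- by move=> /asboolP st /asboolP tu; apply/asboolP; apply: tens_eq_trans st tu.
Qed.

Canonical tens_equiv := EquivRelPack tens_eqb_equiv.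

Definition tens := {eq_quot tens_equiv}.

HB.instance Definition _ := Choice.on tens.
HB.instance Definition _ := EqQuotient.on tens.

Definition tsum s : tens := \pi_tens s.

(* Some decomposition of u as a sum of pure tensors. *)
Definition tdecomp (u : tens) : seq (A * B) := repr u.

Lemma tdecompK u : tsum (tdecomp u) = u. Proof. exact: reprK. Qed.

Lemma tsumP s t : tsum s = tsum t <-> tens_eq s t.
Proof.
split; first by move=> /eqquotP /asboolP.
by move=> st; apply/eqquotP/asboolP.
Qed.

Lemma tdecomp_tsum s : tens_eq (tdecomp (tsum s)) s.
Proof. by apply/tsumP; rewrite tdecompK. Qed.

Definition tens_add (u v : tens) := tsum (tdecomp u ++ tdecomp v).
Definition tens_opp (u : tens) := tsum [seq (- p.1, p.2) | p <- tdecomp u].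

Lemma tsum_cat s t : tsum (s ++ t) = tens_add (tsum s) (tsum t).
Proof.
by apply/tsumP/tens_eq_cat; apply: tens_eq_sym; apply: tdecomp_tsum.
Qed.

Lemma tens_ind (P : tens -> Prop) : (forall s, P (tsum s)) -> forall u, P u.
Proof. by move=> Ps u; rewrite -(tdecompK u). Qed.

Fact tens_addA : associative tens_add.
Proof.
elim/tens_ind => s; elim/tens_ind => t; elim/tens_ind => u.
by rewrite -!tsum_cat catA.
Qed.

Fact tens_addC : commutative tens_add.
Proof.
elim/tens_ind => s; elim/tens_ind => t.
by rewrite -!tsum_cat; apply/tsumP/tens_eq_catC.
Qed.

Fact tens_add0 : left_id (tsum [::]) tens_add.
Proof. by elim/tens_ind => s; rewrite -tsum_cat. Qed.

Fact tens_addN : left_inverse (tsum [::]) tens_opp tens_add.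
Proof.
move=> u; rewrite -{2}(tdecompK u) /tens_opp -tsum_cat; apply/tsumP.
elim: (tdecomp u) => [|[a b] s IH]; first exact: tens_eq_refl.
rewrite /= -cat1s -(cat1s (a, b)).
set n := [seq _ | _ <- s] in IH *.
apply: tens_eq_trans (_ : tens_eq _ (([:: (- a, b)] ++ [:: (a, b)]) ++ (n ++ s))) _.
  rewrite -!catA; apply: tens_eq_cat (tens_eq_refl _) _.
  by rewrite !catA; apply: tens_eq_cat (tens_eq_catC _ _) (tens_eq_refl _).
rewrite -[[::]]/([::] ++ [::]); apply: tens_eq_cat IH.
apply: tens_eq_trans (tens_eq_sym (tens_eq_Dl _ _ _)) _.
by rewrite addNr; apply: tens_eq_0l.
Qed.

HB.instance Definition _ :=
  GRing.isZmodule.Build tens tens_addA tens_addC tens_add0 tens_addN.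

Definition pure a b : tens := tsum [:: (a, b)].
Local Notation "a \ox b" := (pure a b).

Lemma tsumE s : tsum s = \sum_(p <- s) p.1 \ox p.2.
Proof.
by elim: s => [|[a b] s IH]; rewrite ?big_nil // big_cons -IH -cat1s tsum_cat.
Qed.

Lemma tdecompE u : u = \sum_(p <- tdecomp u) p.1 \ox p.2.
Proof. by rewrite -tsumE tdecompK. Qed.

(* The value at u = \sum_i a_i \ox b_i of the additive map sending a \ox b to *)
(* f a b. It is meaningful for f satisfying [balanced] below, and then does   *)
(* not depend on the decomposition of u: see tlift_tsum.                      *)
Definition tlift (W : zmodType) (f : A -> B -> W) (u : tens) : W :=
  \sum_(p <- tdecomp u) f p.1 p.2.

Record balanced (W : zmodType) (f : A -> B -> W) : Prop := Balanced {
  balancedDl : forall a a' b, f (a + a') b = f a b + f a' b;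
  balancedDr : forall a b b', f a (b + b') = f a b + f a b';
  balancedZ : forall c a b, f (c **: a) b = f a (c **: b) }.

Section Lift.
Variables (W : zmodType) (f : A -> B -> W) (fB : balanced f).

Lemma balanced0l b : f 0 b = 0.
Proof. by apply: (addIr (f 0 b)); rewrite -(balancedDl fB) !add0r. Qed.

Lemma balanced0r a : f a 0 = 0.
Proof. by apply: (addIr (f a 0)); rewrite -(balancedDr fB) !add0r. Qed.

Lemma tlift_tsum s : tlift f (tsum s) = \sum_(p <- s) f p.1 p.2.
Proof.
rewrite /tlift; move: (tdecomp (tsum s)) (tdecomp_tsum s) => r; elim=> {r s}.
- by [].
- by move=> s t _ ->.
- by move=> s t u _ -> _ ->.
- by move=> s s' t t' _ E1 _ E2; rewrite !big_cat /= E1 E2.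
- by move=> s t; rewrite !big_cat /= addrC.
- by move=> b; rewrite big_seq1 big_nil /= balanced0l.
- by move=> a; rewrite big_seq1 big_nil /= balanced0r.
- by move=> a a' b; rewrite !big_cons !big_nil /= !addr0 (balancedDl fB).
- by move=> a b b'; rewrite !big_cons !big_nil /= !addr0 (balancedDr fB).
- by move=> c a b; rewrite !big_seq1 /= (balancedZ fB).
Qed.

Lemma tlift_pure a b : tlift f (a \ox b) = f a b.
Proof. by rewrite tlift_tsum big_seq1. Qed.

Lemma tliftD u v : tlift f (u + v) = tlift f u + tlift f v.
Proof.
elim/tens_ind: u => s; elim/tens_ind: v => t.
by rewrite -[_ + _]/(tens_add _ _) -tsum_cat !tlift_tsum big_cat.
Qed.

Lemma tlift0 : tlift f 0 = 0.
Proof. by rewrite -[0 in LHS]/(tsum [::]) tlift_tsum big_nil. Qed.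

Lemma tlift_sum I (r : seq I) (P : pred I) (F : I -> tens) :
  tlift f (\sum_(i <- r | P i) F i) = \sum_(i <- r | P i) tlift f (F i).
Proof. exact: (big_morph _ tliftD tlift0). Qed.
End Lift.

Lemma pure_balanced : balanced pure.
Proof.
split=> *.
- by rewrite -[_ + _ in RHS]/(tens_add _ _) -tsum_cat; apply/tsumP/tens_eq_Dl.
- by rewrite -[_ + _ in RHS]/(tens_add _ _) -tsum_cat; apply/tsumP/tens_eq_Dr.
- exact/tsumP/tens_eq_Z.
Qed.

Lemma pureDl a a' b : (a + a') \ox b = a \ox b + a' \ox b.
Proof. exact: balancedDl pure_balanced _ _ _. Qed.
Lemma pureDr a b b' : a \ox (b + b') = a \ox b + a \ox b'.
Proof. exact: balancedDr pure_balanced _ _ _. Qed.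
Lemma pureZ c a b : (c **: a) \ox b = a \ox (c **: b).
Proof. exact: balancedZ pure_balanced _ _ _. Qed.

Lemma tens_indD (P : tens -> Prop) :
  P 0 -> (forall u v, P u -> P v -> P (u + v)) ->
  (forall a b, P (a \ox b)) -> forall u, P u.
Proof.
move=> P0 PD Pp u; rewrite (tdecompE u).
by elim/big_ind: _ => // p _; apply: Pp.
Qed.

Definition tens_one : tens := 1 \ox 1.
Definition tens_mul (u v : tens) : tens :=
  tlift (fun a b => tlift (fun a' b' => (a * a') \ox (b * b')) v) u.
Definition tens_scale c (u : tens) : tens := tlift (fun a b => (c **: a) \ox b) u.

Lemma tens_mulr_balanced a b :
  balanced (fun a' b' => (a * a') \ox (b * b')).
Proof.
by split=> *; rewrite ?mulrDr ?pureDl ?pureDr // -!ascaleAr pureZ.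
Qed.

Lemma tens_mull_balanced v :
  balanced (fun a b => tlift (fun a' b' => (a * a') \ox (b * b')) v).
Proof.
split=> *; rewrite /tlift -?big_split /=; apply: eq_bigr => p _.
- by rewrite mulrDl pureDl.
- by rewrite mulrDl pureDr.
- by rewrite -!ascaleAl pureZ.
Qed.

Lemma tens_mul_pure a b a' b' :
  tens_mul (a \ox b) (a' \ox b') = (a * a') \ox (b * b').
Proof.
rewrite /tens_mul (tlift_pure (tens_mull_balanced _)).
exact: (tlift_pure (tens_mulr_balanced _ _)).
Qed.

Fact tens_mulDl : left_distributive tens_mul +%R.
Proof. by move=> u v w; exact: (tliftD (tens_mull_balanced w)). Qed.

Fact tens_mulDr : right_distributive tens_mul +%R.
Proof.
move=> u v w; rewrite /tens_mul {1 3 5}/tlift -big_split /=.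
by apply: eq_bigr => p _; rewrite (tliftD (tens_mulr_balanced _ _)).
Qed.

Lemma tens_mul0 v : tens_mul 0 v = 0.
Proof. exact: (tlift0 (tens_mull_balanced v)). Qed.

Lemma tens_mulr0 v : tens_mul v 0 = 0.
Proof.
rewrite /tens_mul {1}/tlift big1 // => p _.
exact: (tlift0 (tens_mulr_balanced _ _)).
Qed.

Fact tens_mulA : associative tens_mul.
Proof.
move=> u v w.
elim/tens_indD: u => [|u u' IH IH'|a b]; first by rewrite !tens_mul0.
  by rewrite !tens_mulDl IH IH'.
elim/tens_indD: v => [|v v' IH IH'|a' b'].
- by rewrite tens_mulr0 !tens_mul0 tens_mulr0.
- by rewrite tens_mulDl !tens_mulDr IH IH' tens_mulDl.
elim/tens_indD: w => [|w w' IH IH'|a'' b'']; first by rewrite !tens_mulr0.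
  by rewrite !tens_mulDr IH IH'.
by rewrite !tens_mul_pure !mulrA.
Qed.

Fact tens_mul1 : left_id tens_one tens_mul.
Proof.
elim/tens_indD => [|u v IH IH'|a b]; first by rewrite tens_mulr0.
  by rewrite tens_mulDr IH IH'.
by rewrite tens_mul_pure !mul1r.
Qed.

Fact tens_mulr1 : right_id tens_one tens_mul.
Proof.
elim/tens_indD => [|u v IH IH'|a b]; first by rewrite tens_mul0.
  by rewrite tens_mulDl IH IH'.
by rewrite tens_mul_pure !mulr1.
Qed.

HB.instance Definition _ := GRing.Zmodule_isPzRing.Build tens
  tens_mulA tens_mul1 tens_mulr1 tens_mulDl tens_mulDr.

Lemma tmul_pure a b a' b' :
  (a \ox b) * (a' \ox b') = (a * a') \ox (b * b').
Proof. exact: tens_mul_pure. Qed.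

Lemma tens_scale_balanced c : balanced (fun a b => (c **: a) \ox b).
Proof.
split=> *; first by rewrite ascaleDr pureDl.
  by rewrite pureDr.
by rewrite ascaleA mulrC -ascaleA pureZ.
Qed.

Lemma tens_scaleE c u : tens_scale c u = ((c **: 1) \ox 1) * u.
Proof.
elim/tens_indD: u => [|u v IH IH'|a b].
- by rewrite mulr0; exact: (tlift0 (tens_scale_balanced c)).
- by rewrite mulrDr -IH -IH'; exact: (tliftD (tens_scale_balanced c)).
rewrite tmul_pure -ascaleAl !mul1r.
exact: (tlift_pure (tens_scale_balanced c)).
Qed.

Fact tens_scaleA c d u : tens_scale c (tens_scale d u) = tens_scale (c * d) u.
Proof. by rewrite !tens_scaleE mulrA tmul_pure -ascaleAl !mul1r ascaleA. Qed.

Fact tens_scale1 u : tens_scale 1 u = u.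
Proof. by rewrite tens_scaleE ascale1 mul1r. Qed.

Fact tens_scaleDr c u v :
  tens_scale c (u + v) = tens_scale c u + tens_scale c v.
Proof. by rewrite !tens_scaleE mulrDr. Qed.

Fact tens_scaleDl u c d :
  tens_scale (c + d) u = tens_scale c u + tens_scale d u.
Proof. by rewrite !tens_scaleE ascaleDl pureDl mulrDl. Qed.

Fact tens_scaleAl c u v : tens_scale c (u * v) = tens_scale c u * v.
Proof. by rewrite !tens_scaleE mulrA. Qed.

Fact tens_scaleAr c u v : tens_scale c (u * v) = u * tens_scale c v.
Proof.
rewrite !tens_scaleE !mulrA; congr (_ * v).
elim/tens_indD: u => [|u u' IH IH'|a b]; first by rewrite mulr0 mul0r.
  by rewrite mulrDr mulrDl IH IH'.
by rewrite !tmul_pure -ascaleAl -ascaleAr !mul1r !mulr1.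
Qed.

HB.instance Definition _ := PzRing_isPzAlgebra.Build k tens
  tens_scaleA tens_scale1 tens_scaleDr tens_scaleDl tens_scaleAl tens_scaleAr.

Lemma pure_ascale c a b : c **: (a \ox b) = (c **: a) \ox b.
Proof. exact: (tlift_pure (tens_scale_balanced c)). Qed.

End Tensor.

Notation "x \ox y" := (pure x y) : ring_scope.

Definition tmap (k : comPzRingType) (A A' B B' : pzAlgType k)
    (f : alg_hom A A') (g : alg_hom B B') (u : tens A B) : tens A' B' :=
  tlift (fun a b => f a \ox g b) u.

Section Endomorphisms.
Variables (k : comPzRingType) (V : lmodType k).

Definition endo := {linear V -> V}.

HB.instance Definition _ := gen_eqMixin endo.
HB.instance Definition _ := gen_choiceMixin endo.

Implicit Types f g h : endo.

Lemma endoP f g : (forall v, f v = g v) -> f = g.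
Proof.
case: f g => f [[Df] [Zf]] [g [[Dg] [Zg]]] /= /funext E; subst g.
by rewrite (Prop_irrelevance Df Dg) (Prop_irrelevance Zf Zg).
Qed.

Definition mk_endo (F : V -> V) (linF : linear F) : endo :=
  let m := GRing.isLinear.Build k V V *:%R F linF in
  HB.pack F m.

Fact endo_zero_linear : linear (fun _ : V => 0 : V).
Proof. by move=> c u v; rewrite scaler0 addr0. Qed.
Fact endo_opp_linear f : linear (fun v => - f v).
Proof. by move=> c u v; rewrite linearP opprD scalerN. Qed.
Fact endo_add_linear f g : linear (fun v => f v + g v).
Proof. by move=> c u v; rewrite !linearP scalerDr addrACA. Qed.
Fact endo_one_linear : linear (fun v : V => v).
Proof. by []. Qed.
Fact endo_mul_linear f g : linear (fun v => f (g v)).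
Proof. by move=> c u v; rewrite !linearP. Qed.
Fact endo_scale_linear (c : k) f : linear (fun v => c *: f v).
Proof. by move=> d u v; rewrite linearP scalerDr !scalerA mulrC. Qed.

Definition endo_zero := mk_endo endo_zero_linear.
Definition endo_opp f := mk_endo (endo_opp_linear f).
Definition endo_add f g := mk_endo (endo_add_linear f g).
Definition endo_one := mk_endo endo_one_linear.
Definition endo_mul f g := mk_endo (endo_mul_linear f g).
Definition endo_scale c f := mk_endo (endo_scale_linear c f).

Fact endo_addA : associative endo_add.
Proof. by move=> f g h; apply: endoP => v /=; rewrite addrA. Qed.
Fact endo_addC : commutative endo_add.
Proof. by move=> f g; apply: endoP => v /=; rewrite addrC. Qed.
Fact endo_add0 : left_id endo_zero endo_add.
Proof. by move=> f; apply: endoP => v /=; rewrite add0r. Qed.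
Fact endo_addN : left_inverse endo_zero endo_opp endo_add.
Proof. by move=> f; apply: endoP => v /=; rewrite addNr. Qed.

HB.instance Definition _ :=
  GRing.isZmodule.Build endo endo_addA endo_addC endo_add0 endo_addN.

Fact endo_mulA : associative endo_mul.
Proof. by move=> f g h; apply: endoP. Qed.
Fact endo_mul1 : left_id endo_one endo_mul.
Proof. by move=> f; apply: endoP. Qed.
Fact endo_mulr1 : right_id endo_one endo_mul.
Proof. by move=> f; apply: endoP. Qed.
Fact endo_mulDl : left_distributive endo_mul +%R.
Proof. by move=> f g h; apply: endoP. Qed.
Fact endo_mulDr : right_distributive endo_mul +%R.
Proof. by move=> f g h; apply: endoP => v; apply: linearD. Qed.

HB.instance Definition _ := GRing.Zmodule_isPzRing.Build endo
  endo_mulA endo_mul1 endo_mulr1 endo_mulDl endo_mulDr.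

Fact endo_scaleA c d f : endo_scale c (endo_scale d f) = endo_scale (c * d) f.
Proof. by apply: endoP => v /=; rewrite scalerA. Qed.
Fact endo_scale1 f : endo_scale 1 f = f.
Proof. by apply: endoP => v /=; rewrite scale1r. Qed.
Fact endo_scaleDr c f g : endo_scale c (f + g) = endo_scale c f + endo_scale c g.
Proof. by apply: endoP => v /=; rewrite scalerDr. Qed.
Fact endo_scaleDl f c d : endo_scale (c + d) f = endo_scale c f + endo_scale d f.
Proof. by apply: endoP => v /=; rewrite scalerDl. Qed.
Fact endo_scaleAl c f g : endo_scale c (f * g) = endo_scale c f * g.
Proof. exact: endoP. Qed.
Fact endo_scaleAr c f g : endo_scale c (f * g) = f * endo_scale c g.
Proof. by apply: endoP => v; rewrite /= linearZ. Qed.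

HB.instance Definition _ := PzRing_isPzAlgebra.Build k endo
  endo_scaleA endo_scale1 endo_scaleDr endo_scaleDl endo_scaleAl endo_scaleAr.

Lemma endo_mulE f g v : (f * g) v = f (g v). Proof. by []. Qed.
Lemma endo_oneE v : (1 : endo) v = v. Proof. by []. Qed.
Lemma endo_addE f g v : (f + g) v = f v + g v. Proof. by []. Qed.
Lemma endo_ascaleE c f v : (c **: f) v = c *: f v. Proof. by []. Qed.

(* MathComp's vectType would require a nonzero ground ring. *)
Definition is_basis n (e : 'I_n -> V) : Prop :=
  forall v, exists! x : 'rV[k]_n, v = \sum_i x 0 i *: e i.

Definition finite_free : Prop := exists n (e : 'I_n -> V), is_basis e.

Definition basis_coord n (e : 'I_n -> V) (v : V) : 'rV[k]_n :=
  xget 0 [set x : 'rV[k]_n | v = \sum_i x 0 i *: e i]%classic.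

Definition endo_mx n (e : 'I_n -> V) f : 'M[k]_n :=
  \matrix_(i, j) basis_coord e (f (e j)) 0 i.

(* The trace of the matrix of f in some basis of V: by endo_traceE the choice *)
(* of basis is immaterial. *)
Definition endo_trace f : k :=
  xget 0 [set t : k | exists n (e : 'I_n -> V),
    is_basis e /\ t = \tr (endo_mx e f)]%classic.

Lemma basis_coordE n (e : 'I_n -> V) v :
  is_basis e -> v = \sum_i basis_coord e v 0 i *: e i.
Proof.
move=> /(_ v)[x [vE _]].
apply: (@xgetPex _ 0 [set y : 'rV[k]_n | v = \sum_i y 0 i *: e i]%classic).
by exists x.
Qed.

Lemma basis_coord_unique n (e : 'I_n -> V) (x : 'rV[k]_n) :
  is_basis e -> basis_coord e (\sum_i x 0 i *: e i) = x.
Proof.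
move=> eB; set v := \sum_i _; have [y [_ yU]] := eB v.
by rewrite -(yU _ (basis_coordE v eB)); apply: yU.
Qed.

Lemma endo_mx_col n (e : 'I_n -> V) f j :
  is_basis e -> f (e j) = \sum_i endo_mx e f i j *: e i.
Proof.
move=> eB; rewrite [LHS](basis_coordE _ eB).
by apply: eq_bigr => i _; rewrite mxE.
Qed.

Lemma basis_mx_unique n m (e : 'I_n -> V) (M N : 'M[k]_(n, m)) :
  is_basis e ->
  (forall j, \sum_i M i j *: e i = \sum_i N i j *: e i) -> M = N.
Proof.
move=> eB MN; apply/matrixP => i j.
have E (P : 'M[k]_(n, m)) :
    \sum_i P i j *: e i = \sum_i (\row_i P i j) 0 i *: e i.
  by apply: eq_bigr => l _; rewrite mxE.
have /rowP/(_ i) : \row_i M i j = \row_i N i j.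
  rewrite -[LHS](basis_coord_unique _ eB) -[RHS](basis_coord_unique _ eB).
  by rewrite -!E MN.
by rewrite !mxE.
Qed.

Lemma basis_mulmx n m p (e : 'I_n -> V) (M : 'M[k]_(n, m)) (N : 'M[k]_(m, p)) j :
  \sum_i N i j *: (\sum_l M l i *: e l) = \sum_l (M *m N) l j *: e l.
Proof.
under eq_bigr do rewrite scaler_sumr.
rewrite exchange_big /=; apply: eq_bigr => l _.
rewrite mxE scaler_suml; apply: eq_bigr => i _.
by rewrite scalerA mulrC.
Qed.

Lemma endo_trace_basis n m (e : 'I_n -> V) (e' : 'I_m -> V) f :
  is_basis e -> is_basis e' -> \tr (endo_mx e f) = \tr (endo_mx e' f).
Proof.
move=> eB eB'.
pose P : 'M[k]_(n, m) := \matrix_(i, j) basis_coord e (e' j) 0 i.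
pose Q : 'M[k]_(m, n) := \matrix_(i, j) basis_coord e' (e j) 0 i.
have PE j : e' j = \sum_i P i j *: e i.
  by rewrite [LHS](basis_coordE _ eB); apply: eq_bigr => i _; rewrite mxE.
have QE j : e j = \sum_i Q i j *: e' i.
  by rewrite [LHS](basis_coordE _ eB'); apply: eq_bigr => i _; rewrite mxE.
have PQ : P *m Q = 1%:M.
  apply: (basis_mx_unique eB) => j; rewrite -basis_mulmx.
  under eq_bigr do rewrite -PE.
  rewrite -QE (bigD1 j) //= !mxE eqxx scale1r big1 ?addr0 // => i.
  by rewrite !mxE => /negbTE->; rewrite scale0r.
have fP : P *m endo_mx e' f = endo_mx e f *m P.
  apply: (basis_mx_unique eB) => j; rewrite -!basis_mulmx.
  under eq_bigr do rewrite -PE.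
  under [RHS]eq_bigr do rewrite -(endo_mx_col f _ eB).
  rewrite -(endo_mx_col f _ eB') {1}(PE j) linear_sum.
  by apply: eq_bigr => i _; rewrite linearZ.
have QP : Q *m P = 1%:M.
  apply: (basis_mx_unique eB') => j; rewrite -basis_mulmx.
  under eq_bigr do rewrite -QE.
  rewrite -PE (bigD1 j) //= !mxE eqxx scale1r big1 ?addr0 // => i.
  by rewrite !mxE => /negbTE->; rewrite scale0r.
rewrite -[endo_mx e f]mulmx1 -PQ mulmxA -fP mxtrace_mulC mulmxA.
by rewrite QP mul1mx.
Qed.

Lemma endo_traceE n (e : 'I_n -> V) f :
  is_basis e -> endo_trace f = \tr (endo_mx e f).
Proof.
move=> eB; rewrite /endo_trace; case: xgetP => [t _ [m [e' [eB' ->]]]|].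
  exact: endo_trace_basis.
by move/(_ (\tr (endo_mx e f))); case; exists n, e.
Qed.

End Endomorphisms.

(* With R = \sum_i alpha_i \ox beta_i, tlift (fun a b => F a b) R stands for  *)
(* \sum_i F alpha_i beta_i. The triple tensor product is (A \ox A) \ox A.     *)
Section XC.
Variables (k : comPzRingType) (A : pzAlgType k).

Definition R12 (R : tens A A) : tens (tens A A) A := R \ox 1.
Definition R13 (R : tens A A) : tens (tens A A) A :=
  tlift (fun a b => (a \ox 1) \ox b) R.
Definition R23 (R : tens A A) : tens (tens A A) A :=
  tlift (fun a b => (1 \ox a) \ox b) R.

Record xcAlgebra := XCAlgebra {
  xcR : tens A A;
  xcRV : tens A A;
  xcK : A;
  xcKV : A;
  xcRRV : xcR * xcRV = 1;
  xcRVR : xcRV * xcR = 1;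
  xcKKV : xcK * xcKV = 1;
  xcKVK : xcKV * xcK = 1;
  XC0 : xcR = (xcK \ox xcK) * xcR * (xcKV \ox xcKV);
  XC0V : xcRV = (xcK \ox xcK) * xcRV * (xcKV \ox xcKV);
  XC1f : tlift (fun a b => b * xcK * a) xcR
         = tlift (fun a b => a * xcKV * b) xcR;
  XC2c : 1 \ox xcKV
         = tlift (fun a b =>
             tlift (fun a' b' => (a * a') \ox (b' * xcKV * b)) xcRV) xcR;
  XC2d : xcK \ox 1
         = tlift (fun a b =>
             tlift (fun a' b' => (a' * xcK * a) \ox (b * b')) xcRV) xcR;
  XC3 : R12 xcR * R13 xcR * R23 xcR = R23 xcR * R13 xcR * R12 xcR }.

Record tracedXCAlgebra := TracedXCAlgebra {
  txc :> xcAlgebra;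
  xctr : A -> k;
  xctrD : forall a b, xctr (a + b) = xctr a + xctr b;
  xctrZ : forall c a, xctr (c **: a) = c * xctr a;
  xctr_mulC : forall a b, xctr (a * b) = xctr (b * a) }.
End XC.

(* Main.v *)
(* Every axiom of an XC-algebra is an identity between values of balanced maps *)
(* at R and its inverse, so any algebra morphism f : A -> B transports an       *)
(* XC-structure from A to B by applying f, f \ox f or (f \ox f) \ox f to both    *)
(* sides; tlift_tmap is this naturality. The trace is cyclic because it is the *)
(* trace of matrices in any basis of V.                                        *)
Require Import Defs.
From HB Require Import structures.
From mathcomp Require Import all_boot all_order all_algebra.

Import GRing.Theory.
Local Open Scope ring_scope.

(** The axioms compare expressions built from R, its inverse and the balancing element by products,
    units and balanced maps. For an algebra morphism [f], [tmap f f] is again an algebra morphism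
    ([tmap_hom]), and [tlift_tmap] carries values of balanced maps along it, so [xc_push] transports
    the structure along any [f], in particular along [rho]. Finite freeness enters through the
    trace: a basis makes [endo_mx] compatible with sums, scalars and products, so cyclicity is that
    of matrices. *)

Section TensorMap.
Context {k : comPzRingType} {A A' B B' : pzAlgType k}.
Variables (f : alg_hom A A') (g : alg_hom B B').

Lemma tmap_balanced : balanced (fun a b => f a \ox g b).
Proof. by split=> *; rewrite ?rmorphD ?pureDl ?pureDr ?alg_homZ ?pureZ. Qed.

Lemma tmap_pure a b : tmap f g (a \ox b) = f a \ox g b.
Proof. exact: (tlift_pure tmap_balanced). Qed.

Lemma tmap0 : tmap f g 0 = 0.
Proof. exact: (tlift0 tmap_balanced). Qed.

Lemma tmapD u v : tmap f g (u + v) = tmap f g u + tmap f g v.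
Proof. exact: (tliftD tmap_balanced). Qed.

Lemma tmap1 : tmap f g 1 = 1.
Proof. by rewrite [LHS]tmap_pure !rmorph1. Qed.

Lemma tmapM u v : tmap f g (u * v) = tmap f g u * tmap f g v.
Proof.
elim/tens_indD: u => [|u u' IH IH'|a b]; first by rewrite mul0r tmap0 mul0r.
  by rewrite mulrDl !tmapD IH IH' mulrDl.
elim/tens_indD: v => [|v v' IH IH'|a' b']; first by rewrite mulr0 tmap0 mulr0.
  by rewrite mulrDr !tmapD IH IH' mulrDr.
by rewrite tmul_pure !tmap_pure tmul_pure !rmorphM.
Qed.

Lemma tmapZ c u : tmap f g (c **: u) = c **: tmap f g u.
Proof.
elim/tens_indD: u => [|u v IH IH'|a b]; first by rewrite ascaler0 tmap0 ascaler0.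
  by rewrite ascaleDr !tmapD IH IH' ascaleDr.
by rewrite pure_ascale !tmap_pure alg_homZ pure_ascale.
Qed.

Definition tmap_rmorph : {rmorphism tens A B -> tens A' B'} :=
  let mD := GRing.isNmodMorphism.Build _ _ (tmap f g) (tmap0, tmapD) in
  let mM := GRing.isMonoidMorphism.Build _ _ (tmap f g) (tmap1, tmapM) in
  HB.pack (tmap f g) mD mM.

Definition tmap_hom : alg_hom (tens A B) (tens A' B') := @AlgHom _ _ _ tmap_rmorph tmapZ.

(** Additivity moves [h] inside the sum over the chosen decomposition of [u]. The image pairs
    decompose [tmap f g u] but need not be its chosen decomposition, hence the balancedness of
    [F']. *)
Lemma tlift_tmap {W W' : zmodType} {h : W -> W'} {F : A -> B -> W}
    {F' : A' -> B' -> W'} (u : tens A B) :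
    h 0 = 0 -> {morph h : x y / x + y} -> balanced F' ->
    (forall a b, h (F a b) = F' (f a) (g b)) ->
  h (tlift F u) = tlift F' (tmap f g u).
Proof.
move=> h0 hD F'B hF.
have -> : tmap f g u = \sum_(p <- tdecomp u) f p.1 \ox g p.2 by [].
rewrite (tlift_sum F'B) /tlift (big_morph h hD h0); apply: eq_bigr => p _.
by rewrite -/(tlift F' _) (tlift_pure F'B) hF.
Qed.

End TensorMap.

Section Balanced.
Context {k : comPzRingType} {A : pzAlgType k}.
Implicit Types (x a b : A) (u : tens A A).

Lemma mul_balanced x : balanced (fun a b => a * x * b).
Proof. by split=> *; rewrite ?mulrDl ?mulrDr -?ascaleAl -?ascaleAr. Qed.

Lemma mulC_balanced x : balanced (fun a b => b * x * a).
Proof. by split=> *; rewrite ?mulrDl ?mulrDr -?ascaleAl -?ascaleAr. Qed.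

Lemma R13_balanced : balanced (fun a b => (a \ox (1 : A)) \ox b : tens (tens A A) A).
Proof. by split=> *; rewrite ?pureDl ?pureDr // -pure_ascale pureZ. Qed.

Lemma R23_balanced : balanced (fun a b => ((1 : A) \ox a) \ox b : tens (tens A A) A).
(* A scalar on the middle factor first moves to the left one, where it acts on the whole of
   [1 \ox a] and can cross the outer tensor. *)
Proof. by split=> *; rewrite ?pureDr ?pureDl // -pureZ -pure_ascale pureZ. Qed.

Lemma XC2c_inner_balanced x a b :
  balanced (fun a' b' => (a * a') \ox (b' * x * b)).
Proof.
by split=> *; rewrite ?mulrDl ?mulrDr ?pureDl ?pureDr // -?ascaleAl -?ascaleAr pureZ.
Qed.

(** The decomposition of [u] does not depend on the outer pair, so the identities hold term by
    term. *)
Lemma XC2c_outer_balanced x u :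
  balanced (fun a b => tlift (fun a' b' => (a * a') \ox (b' * x * b)) u).
Proof.
split=> *; rewrite /tlift -?big_split /=; apply: eq_bigr => p _.
- by rewrite mulrDl pureDl.
- by rewrite mulrDr pureDr.
- by rewrite -ascaleAl -ascaleAr pureZ.
Qed.

Lemma XC2d_inner_balanced x a b :
  balanced (fun a' b' => (a' * x * a) \ox (b * b')).
Proof.
by split=> *; rewrite ?mulrDl ?mulrDr ?pureDl ?pureDr // -?ascaleAl -?ascaleAr pureZ.
Qed.

Lemma XC2d_outer_balanced x u :
  balanced (fun a b => tlift (fun a' b' => (a' * x * a) \ox (b * b')) u).
Proof.
split=> *; rewrite /tlift -?big_split /=; apply: eq_bigr => p _.
- by rewrite mulrDr pureDl.
- by rewrite mulrDl pureDr.
- by rewrite -ascaleAl -ascaleAr pureZ.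
Qed.

End Balanced.

Section PushForward.
Context {k : comPzRingType} {A B : pzAlgType k}.
Variables (f : alg_hom A B) (X : xcAlgebra A).

Let R' := tmap f f (xcR X).
Let RV' := tmap f f (xcRV X).
Let K' := f (xcK X).
Let KV' := f (xcKV X).

(** Being multiplicative on triple tensors, [f3] carries the Yang-Baxter equation [XC3] once it is
    known to commute with [R12], [R13] and [R23]. *)
Let f3 := tmap_hom (tmap_hom f f) f.

Lemma R12_tmap u : R12 (tmap f f u) = f3 (R12 u).
Proof. by rewrite /R12 /= tmap_pure rmorph1. Qed.

Lemma R13_tmap u : R13 (tmap f f u) = f3 (R13 u).
Proof.
apply/esym/tlift_tmap; [exact: tmap0|exact: tmapD|exact: R13_balanced|].
by move=> a b; rewrite /= !tmap_pure /= tmap_pure rmorph1.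
Qed.

Lemma R23_tmap u : R23 (tmap f f u) = f3 (R23 u).
Proof.
apply/esym/tlift_tmap; [exact: tmap0|exact: tmapD|exact: R23_balanced|].
by move=> a b; rewrite /= !tmap_pure /= tmap_pure rmorph1.
Qed.

Fact push_RRV : R' * RV' = 1.
Proof. by rewrite -tmapM xcRRV tmap1. Qed.

Fact push_RVR : RV' * R' = 1.
Proof. by rewrite -tmapM xcRVR tmap1. Qed.

Fact push_KKV : K' * KV' = 1.
Proof. by rewrite -rmorphM xcKKV rmorph1. Qed.

Fact push_KVK : KV' * K' = 1.
Proof. by rewrite -rmorphM xcKVK rmorph1. Qed.

Fact push_XC0 : R' = (K' \ox K') * R' * (KV' \ox KV').
Proof. by rewrite -!tmap_pure -!tmapM -XC0. Qed.

Fact push_XC0V : RV' = (K' \ox K') * RV' * (KV' \ox KV').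
Proof. by rewrite -!tmap_pure -!tmapM -XC0V. Qed.

Fact push_XC1f :
  tlift (fun a b => b * K' * a) R' = tlift (fun a b => a * KV' * b) R'.
Proof.
transitivity (f (tlift (fun a b => b * xcK X * a) (xcR X))).
  apply/esym/tlift_tmap; [exact: rmorph0|exact: rmorphD|exact: mulC_balanced|].
  by move=> a b; rewrite !rmorphM.
rewrite XC1f; apply: tlift_tmap; [exact: rmorph0|exact: rmorphD|exact: mul_balanced|].
by move=> a b; rewrite !rmorphM.
Qed.

Fact push_XC2c :
  1 \ox KV' =
  tlift (fun a b => tlift (fun a' b' => (a * a') \ox (b' * KV' * b)) RV') R'.
Proof.
(* Writing 1 as [f 1] makes the left side an image under [tmap f f]. Naturality is then used twice:
   outside for R, inside for its inverse. *)
rewrite -(rmorph1 f) -tmap_pure XC2c.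
apply: tlift_tmap; [exact: tmap0|exact: tmapD|exact: XC2c_outer_balanced|] => a b.
apply: tlift_tmap; [exact: tmap0|exact: tmapD|exact: XC2c_inner_balanced|] => a' b'.
by rewrite tmap_pure !rmorphM.
Qed.

Fact push_XC2d :
  K' \ox 1 =
  tlift (fun a b => tlift (fun a' b' => (a' * K' * a) \ox (b * b')) RV') R'.
Proof.
rewrite -(rmorph1 f) -tmap_pure XC2d.
apply: tlift_tmap; [exact: tmap0|exact: tmapD|exact: XC2d_outer_balanced|] => a b.
apply: tlift_tmap; [exact: tmap0|exact: tmapD|exact: XC2d_inner_balanced|] => a' b'.
by rewrite tmap_pure !rmorphM.
Qed.

Fact push_XC3 : R12 R' * R13 R' * R23 R' = R23 R' * R13 R' * R12 R'.
Proof. by rewrite R12_tmap R13_tmap R23_tmap -!rmorphM XC3. Qed.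

Definition xc_push : xcAlgebra B :=
  XCAlgebra push_RRV push_RVR push_KKV push_KVK push_XC0 push_XC0V
    push_XC1f push_XC2c push_XC2d push_XC3.

End PushForward.

Section EndoTrace.
Context {k : comPzRingType} {V : lmodType k} {n : nat} {e : 'I_n -> V}.
Hypothesis eB : is_basis e.
Implicit Types f g : endo V.

Lemma endo_mxD f g : endo_mx e (f + g) = endo_mx e f + endo_mx e g.
Proof.
apply: (basis_mx_unique eB) => j; rewrite -endo_mx_col // endo_addE.
rewrite (endo_mx_col f) // (endo_mx_col g) // -big_split /=.
by apply: eq_bigr => i _; rewrite [in RHS]mxE scalerDl.
Qed.

Lemma endo_mxZ c f : endo_mx e (c **: f) = c *: endo_mx e f.
Proof.
apply: (basis_mx_unique eB) => j; rewrite -endo_mx_col // endo_ascaleE.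
rewrite (endo_mx_col f) // scaler_sumr.
by apply: eq_bigr => i _; rewrite [in RHS]mxE scalerA.
Qed.

(** Column [j] expands [g (e j)] in the basis and applies [f] linearly; [basis_mulmx] recognises the
    product, and coordinates are unique. *)
Lemma endo_mxM f g : endo_mx e (f * g) = endo_mx e f *m endo_mx e g.
Proof.
apply: (basis_mx_unique eB) => j; rewrite -endo_mx_col // endo_mulE.
rewrite -basis_mulmx (endo_mx_col g) // linear_sum.
by apply: eq_bigr => i _; rewrite linearZ /= (endo_mx_col f).
Qed.

End EndoTrace.

Section FiniteFreeTrace.
Context {k : comPzRingType} {V : lmodType k}.
Hypothesis V_free : finite_free V.
Implicit Types f g : endo V.

(** [endo_traceE] lets all the traces be computed in one common basis. *)
Lemma endo_traceD f g : endo_trace (f + g) = endo_trace f + endo_trace g.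
Proof.
by have [n [e eB]] := V_free; rewrite !(endo_traceE _ eB) endo_mxD // mxtraceD.
Qed.

Lemma endo_traceZ c f : endo_trace (c **: f) = c * endo_trace f.
Proof.
by have [n [e eB]] := V_free; rewrite !(endo_traceE _ eB) endo_mxZ // mxtraceZ.
Qed.

Lemma endo_trace_mulC f g : endo_trace (f * g) = endo_trace (g * f).
Proof.
by have [n [e eB]] := V_free; rewrite !(endo_traceE _ eB) !endo_mxM // mxtrace_mulC.
Qed.

End FiniteFreeTrace.

Theorem lemma4p11 (k : comPzRingType) (A : pzAlgType k) (X : xcAlgebra A)
    (V : lmodType k) (V_free : finite_free V) (rho : alg_hom A (endo V)) :
  exists T : tracedXCAlgebra (endo V),
    [/\ xcR T = tmap rho rho (xcR X),
        xcK T = rho (xcK X)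
      & xctr T = @endo_trace k V].
Proof.
by exists (@TracedXCAlgebra _ _ (xc_push rho X) _ (endo_traceD V_free)
  (endo_traceZ V_free) (endo_trace_mulC V_free)).
Qed.
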